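(* Let $n\in\mathbb{N}$, let $G_n$ be the gain of the game with parameter $n$, and let $p_{k,n}=\mathbb{P}(G_n=k)$ for $1\le k\le n$. Then: (1) $p_{1,n}=\frac1n$ and, for $2\le k\le n$, $$p_{k,n}=\Bigl(1-\sum_{i=1}^{k-1}p_{i,n}\Bigr)\cdot\frac{k}{n}=p_{k-1,n}\cdot k\cdot\Bigl(\frac{1}{k-1}-\frac1n\Bigr).$$ The last probability is $p_{n,n}=1-\sum_{i=1}^{n-1}p_{i,n}$, and $\sum_{k=1}^{n}p_{k,n}=1$. (2) For $2\le k\le n$, $$p_{k,n}=\frac1n\cdot\prod_{i=2}^{k} i\cdot\Bigl(\frac{1}{i-1}-\frac1n\Bigr),$$ and for $1\le k\le n$, $$p_{k,n}=\frac{k}{n^k}\cdot\frac{(n-1)!}{(n-k)!}.$$ (3) The cumulative distribution function $P_n(x)=\mathbb{P}(G_n\le x)$ of $G_n$ is $$P_n(x)=\sum_{i=1}^{\chi}p_{i,n}=1-\frac{(n-1)!}{n^{\chi}\,(n-1-\chi)!}\quad\text{with}\quad \chi=\lfloor x\rfloor,$$ where $\lfloor x\rfloor$ is the largest integer that does not exceed $x$.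
   Context: The game with parameter $n$: let $X_1,X_2,\ldots$ be independent random variables, each uniformly distributed on $\{1,2,\ldots,n\}$. For $k=1,2,\ldots,n$ in turn, if $X_k\le k$ then the player stops at time $\tau=k$ and the gain is $G_n=k$. That is, $G_n$ is the first index $k\in\{1,\ldots,n\}$ with $X_k\le k$ (such an index exists since $X_n\le n$ always).
   Formalization: In (3) the closed form is stated only for 0 ≤ χ ≤ n−1, since (n−1−χ)! is undefined for χ ≥ n and the formula fails for x < −1 (n=2, χ=−2 gives 1/3, not 0); instead P_n(x)=1 is stated for χ ≥ n and P_n(x)=0 for x < 0. *)

(* Defs.v *)
From HB Require Import structures.
From mathcomp Require Import all_boot all_order all_algebra.
From mathcomp Require Import all_classical all_reals all_analysis.

Set Implicit Arguments.
Unset Strict Implicit.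
Unset Printing Implicit Defensive.

Import Order.TTheory GRing.Theory Num.Theory.

Local Open Scope classical_set_scope.
Local Open Scope ring_scope.

(* Mutual independence of the family (X i)_(i in D): the product rule over
   every finite subfamily, a duplicate-free sequence s of indices in D. *)
Definition mutually_independent d d' (T : measurableType d)
    (T' : measurableType d') (R : realType) (P : probability T R)
    (I : choiceType) (D : set I) (X : I -> {RV P >-> T'}) : Prop :=
  forall (s : seq I) (B : I -> set T'),
    uniq s -> [set` s] `<=` D -> (forall i, measurable (B i)) ->
    P (\bigcap_(i in [set` s]) (X i @^-1` B i)) =
    (\prod_(i <- s) P (X i @^-1` B i))%E.

(* For n > 0 these n masses sum to 1, so they determine the law of Y. *)
Definition uniform_on_1n d (T : measurableType d) (R : realType)
    (P : probability T R) (n : nat) (Y : {RV P >-> nat}) : Prop :=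
  forall j : nat, (1 <= j <= n)%N -> distribution P Y [set j] = (n%:R^-1)%:E.

Section gain.
Context d (T : measurableType d) (R : realType) (P : probability T R).
Context (n : nat) (X : nat -> {RV P >-> nat}).

(* The first k in 1, ..., n with X k w <= k. The default value 0 is returned
   only if there is no such k, hence only if X n w > n. *)
Definition stopping_time (w : T) : nat :=
  head 0%N [seq k <- iota 1 n | (X k w <= k)%N].

Definition gain (w : T) : R := (stopping_time w)%:R.

Lemma measurable_gain : measurable_fun setT gain.
Proof.
rewrite /gain /stopping_time; elim: (iota 1 n) => [|k s IH] /=.
  exact: measurable_cst.
have -> : (fun w => (head 0%N (if (X k w <= k)%N
      then k :: [seq i <- s | (X i w <= i)%N]
      else [seq i <- s | (X i w <= i)%N]))%:R) =
    (fun w => if (X k w <= k)%N then k%:R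
      else (head 0%N [seq i <- s | (X i w <= i)%N])%:R) :> (T -> R).
  by apply/funext => w; case: ifP.
apply: measurable_fun_ifT => //.
by apply: (measurableT_comp (f := fun m : nat => (m <= k)%N)).
Qed.

HB.instance Definition _ :=
  isMeasurableFun.Build _ _ T R gain measurable_gain.

End gain.

(* The gain G_n, as a real random variable on the space of the X k. *)
Definition gain_rv d (T : measurableType d) (R : realType)
    (P : probability T R) (n : nat) (X : nat -> {RV P >-> nat}) :
  {RV P >-> R} := gain n X.

(* Main.v *)
(* Independence of the X_j gives P(X_j > j for all j <= k) = S_k with
   S_k = prod_(j <= k) (1 - j/n), hence P(G_n = k) = S_(k-1) * k/n, which
   telescopes as S_(k-1) - S_k. Everything else is algebra on S_k, which is
   (n-1)! / (n^k (n-1-k)!) for k < n and vanishes for k >= n; in particular the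
   default value 0 of the stopping time has probability S_n = 0. *)

Require Import Defs.
From HB Require Import structures.
From mathcomp Require Import all_boot all_order all_algebra.
From mathcomp Require Import all_classical all_reals all_analysis.
From mathcomp Require Import ring zify.

Set Implicit Arguments.
Unset Strict Implicit.
Unset Printing Implicit Defensive.

Import Order.TTheory GRing.Theory Num.Theory.

Local Open Scope classical_set_scope.
Local Open Scope ring_scope.

(** * The survival products S_k *)

Definition survival (R : realType) (n k : nat) : R :=
  \prod_(1 <= j < k.+1) (1 - j%:R / n%:R).

Section survival_theory.
Context (R : realType) (n : nat) (n_gt0 : (0 < n)%N).
Implicit Types k : nat.

Let n_neq0 : n%:R != 0 :> R. Proof. by rewrite pnatr_eq0 -lt0n. Qed.

Lemma survival0 : survival R n 0 = 1.
Proof. by rewrite /survival big_geq. Qed.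

Lemma survivalS k :
  survival R n k.+1 = survival R n k * (1 - k.+1%:R / n%:R).
Proof. by rewrite /survival big_nat_recr. Qed.

(** The factor at j = n is 1 - n/n = 0. *)
Lemma survival_eq0 k : (n <= k)%N -> survival R n k = 0.
Proof.
elim: k => [|k IH]; first by rewrite leqNgt n_gt0.
rewrite survivalS leq_eqVlt => /predU1P[<-|/IH ->]; last by rewrite mul0r.
by rewrite divff// subrr mulr0.
Qed.

(** The factors are (n - j)/n, and the numerators (n-1)...(n-k) form the quotient of the two
    factorials. *)
Lemma survival_fact k : (k < n)%N ->
  survival R n k = (n.-1)`!%:R / (n%:R ^+ k * (n.-1 - k)`!%:R).
Proof.
have f0 m : m`!%:R != 0 :> R by rewrite pnatr_eq0 -lt0n fact_gt0.
elim: k => [|k IH] kn; first by rewrite survival0 expr0 mul1r subn0 divff.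
rewrite survivalS IH ?(ltnW kn)//.
(* The number n-1-k > 0 is both the leading factor of (n-1-k)! and the numerator of the new factor 1
   - (k+1)/n, so it cancels. *)
have -> : (n.-1 - k = (n.-1 - k.+1).+1)%N by lia.
have e : n%:R = (n.-1 - k.+1).+1%:R + k.+1%:R :> R.
  by rewrite -natrD; congr _%:R; lia.
have -> : 1 - k.+1%:R / n%:R = (n.-1 - k.+1).+1%:R / n%:R :> R.
  by rewrite -{1}(divff n_neq0) -mulrBl e addrK.
rewrite factS natrM exprS.
have m0 : (n.-1 - k.+1).+1%:R != 0 :> R by rewrite pnatr_eq0.
by field; apply/and4P; split => //; exact: expf_neq0.
Qed.

(** Since i/n = 1 - (1 - i/n), the term of index i is S_(i-1) - S_i. *)
Lemma sum_survival k :
  \sum_(1 <= i < k.+1) survival R n i.-1 * (i%:R / n%:R) = 1 - survival R n k.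
Proof.
elim: k => [|k IH]; first by rewrite big_geq// survival0 subrr.
by rewrite big_nat_recr//= IH survivalS; ring.
Qed.

End survival_theory.

(** * Tail probabilities of a uniform variable *)

Section uniform.
Context d (T : measurableType d) (R : realType) (P : probability T R).
Context (n : nat) (n_gt0 : (0 < n)%N) (Y : {RV P >-> nat}).
Hypothesis Y_unif : uniform_on_1n n Y.

Let n_neq0 : n%:R != 0 :> R. Proof. by rewrite pnatr_eq0 -lt0n. Qed.

Let measurable_preimage (A : set nat) : measurable (Y @^-1` A).
Proof. by rewrite -[X in measurable X]setTI; exact: measurable_funPT. Qed.

Let uniform_eq j : (1 <= j <= n)%N -> P (Y @^-1` [set j]) = (n%:R^-1)%:E.
Proof. exact: Y_unif. Qed.

Let uniform_iota j : (j <= n)%N ->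
  P (Y @^-1` [set m | (1 <= m <= j)%N]) = (j%:R / n%:R)%:E.
Proof.
elim: j => [_|j IH jn].
  rewrite mul0r [X in P X](_ : _ = set0) ?measure0//.
  by apply/seteqP; split => w //=; lia.
have -> : [set m | (1 <= m <= j.+1)%N] =
    [set m | (1 <= m <= j)%N] `|` [set j.+1].
  by apply/seteqP; split => m /=; [move=> h|case=> [|->]]; lia.
rewrite preimage_setU measureU//=; last first.
  by apply/seteqP; split => w //= -[]; lia.
rewrite IH ?(ltnW jn)// uniform_eq ?jn//.
by rewrite -EFinD -[in RHS]natr1 mulrDl mul1r.
Qed.

(* The masses on 1, ..., n already exhaust the probability. *)
Let uniform_0 : P (Y @^-1` [set 0%N]) = 0%E.
Proof.
apply/eqP; rewrite eq_le measure_ge0 andbT.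
have : (P (Y @^-1` ([set 0%N] `|` [set m | (1 <= m <= n)%N])) <= 1)%E.
  exact: probability_le1.
rewrite preimage_setU measureU//=; last first.
  by apply/seteqP; split => w //= -[]; lia.
rewrite uniform_iota// divff//.
by rewrite -{2}(add0e 1%E) leeD2rE.
Qed.

(** The variable takes values in [nat], so the event also contains the value 0, which is null. *)
Lemma uniform_le j : (j <= n)%N ->
  P (Y @^-1` [set m | (m <= j)%N]) = (j%:R / n%:R)%:E.
Proof.
move=> jn.
have -> : [set m | (m <= j)%N] = [set 0%N] `|` [set m | (1 <= m <= j)%N].
  by apply/seteqP; split => m /=; [move=> h|case=> [->|]]; lia.
rewrite preimage_setU measureU//=; last first.
  by apply/seteqP; split => w //= -[]; lia.
by rewrite uniform_0 add0e uniform_iota.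
Qed.

Lemma uniform_gt j : (j <= n)%N ->
  P (Y @^-1` [set m | (j < m)%N]) = (1 - j%:R / n%:R)%:E.
Proof.
move=> jn; have -> : [set m | (j < m)%N] = ~` [set m | (m <= j)%N].
  by apply/seteqP; split => m /=; lia.
by rewrite -preimage_setC probability_setC ?uniform_le// EFinB.
Qed.

End uniform.

Lemma set_iota1 k : [set` iota 1 k] = [set j | (1 <= j <= k)%N].
Proof. by apply/seteqP; split => j; rewrite /mkset mem_iota add1n. Qed.

(** * The stopping time and its level sets *)

Section stopping_time.
Context d (T : measurableType d) (R : realType) (P : probability T R).
Context (n : nat) (n_gt0 : (0 < n)%N) (X : nat -> {RV P >-> nat}).

(** Gives access to the theory of [find]. Position i of [iota 1 n] holds the index i + 1, and i = n
    means that no index qualifies. *)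
Lemma stopping_time_find w (q := fun k => (X k w <= k)%N)
    (i := find q (iota 1 n)) :
  stopping_time n X w = if (i < n)%N then i.+1 else 0%N.
Proof.
have head_filter s : head 0%N [seq k <- s | q k] = nth 0%N s (find q s).
  by elim: s => //= k s IH; case: ifP.
rewrite /stopping_time head_filter -/i; case: ltnP => ni.
  by rewrite nth_iota.
by rewrite nth_default// size_iota.
Qed.

Lemma stopping_time_le w : (stopping_time n X w <= n)%N.
Proof. by rewrite stopping_time_find; case: ifP. Qed.

(** One condition per index, the shape required by the product rule: rounds 1, ..., k fail and round
    k + 1 succeeds. *)
Lemma stopping_time_eqS k : (k < n)%N ->
  [set w | stopping_time n X w = k.+1] =
  \bigcap_(j in [set` iota 1 k.+1])
    X j @^-1` (if (j <= k)%N then [set m | (j < m)%N]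
               else [set m | (m <= j)%N]).
Proof.
move=> kn; rewrite set_iota1.
apply/seteqP; split => w /=; rewrite stopping_time_find.
- set q := (fun j : nat => _ : bool); case: ifP => // fn [fk] j /=.
  move=> /andP[j1 jk]; case: leqP => [jlek|klej] /=.
    (* Index j sits at position j - 1, strictly before the first success at position k. *)
    have := @before_find _ 0%N q (iota 1 n) j.-1.
    rewrite fk nth_iota ?add1n ?prednK//; last by lia.
    by move=> h; rewrite ltnNge -/(q j) h//; lia.
  have -> : j = k.+1 by lia.
  have := @nth_find _ 0%N q (iota 1 n).
  by rewrite has_find size_iota fn fk nth_iota//; exact.
- set q := (fun j : nat => _ : bool) => h.
  have qk : q k.+1.
    have := h k.+1; rewrite /= ltnn; apply; lia.
  have fk : (find q (iota 1 n) <= k)%N.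
    rewrite leqNgt; apply/negP => /(before_find 0%N).
    by rewrite nth_iota// add1n qk.
  rewrite (leq_ltn_trans fk kn); congr _.+1; apply/eqP.
  rewrite eqn_leq fk leqNgt; apply/negP => fltk.
  (* A first success at a position f < k would contradict the failure of round f + 1. *)
  have := @nth_find _ 0%N q (iota 1 n).
  rewrite has_find size_iota (leq_ltn_trans fk kn) nth_iota; last by lia.
  move=> /(_ isT); rewrite add1n.
  have := h (find q (iota 1 n)).+1; rewrite /= fltk ltnS (ltnW fltk).
  by move=> /(_ isT) /=; rewrite ltnNge => /negP.
Qed.

Lemma stopping_time_eq0 :
  [set w | stopping_time n X w = 0%N] `<=`
  \bigcap_(j in [set` iota 1 n]) X j @^-1` [set m | (j < m)%N].
Proof.
rewrite set_iota1 => w /=; rewrite stopping_time_find.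
set q := (fun j : nat => _ : bool); case: ltnP => // nf _ j /= /andP[j1 jn].
rewrite ltnNge -/(q j); apply/negP => qj.
have : has q (iota 1 n) by apply/hasP; exists j => //; rewrite mem_iota j1.
by rewrite has_find size_iota ltnNge nf.
Qed.

(** Inherited from the real-valued gain, as the cast from [nat] is injective. *)
Lemma measurable_stopping_time k :
  measurable [set w | stopping_time n X w = k].
Proof.
have -> : [set w | stopping_time n X w = k] =
    gain_rv n X @^-1` [set k%:R : R].
  apply/seteqP; split => w /=; rewrite /gain_rv /gain; first by move->.
  by move/eqP; rewrite eqr_nat => /eqP.
by rewrite -[X in measurable X]setTI; exact: measurable_funPT.
Qed.

(** * Law of the stopping time and of the gain *)

Hypothesis X_indep : mutually_independent [set k : nat | (1 <= k)%N] X.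
Hypothesis X_unif : forall k : nat, (1 <= k)%N -> uniform_on_1n n (X k).

Let iota1_subset k : [set` iota 1 k] `<=` [set j : nat | (1 <= j)%N].
Proof. by rewrite set_iota1 => j /andP[]. Qed.

Lemma prod_uniform_gt k : (k <= n)%N ->
  (\prod_(j <- iota 1 k) P (X j @^-1` [set m | (j < m)%N]))%E =
  (survival R n k)%:E.
Proof.
move=> kn; rewrite /survival /index_iota subn1 /= -prodEFin.
apply: eq_big_seq => j; rewrite mem_iota => /andP[j1 jk].
by rewrite (uniform_gt n_gt0 (X_unif j1))//; lia.
Qed.

Lemma probability_stopping_time0 : P [set w | stopping_time n X w = 0%N] = 0%E.
Proof.
apply/eqP; rewrite eq_le measure_ge0 andbT.
(* The bound 0 is S_n, the probability that all n rounds fail; monotonicity then concludes. *)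
have -> : 0%E = P (\bigcap_(j in [set` iota 1 n])
    X j @^-1` [set m | (j < m)%N]).
  rewrite (X_indep (B := fun j => [set m | (j < m)%N])) ?iota_uniq//.
  by rewrite prod_uniform_gt// survival_eq0.
apply: le_measure; last exact: stopping_time_eq0.
  by rewrite inE; exact: measurable_stopping_time.
rewrite inE; apply: fin_bigcap_measurable => // j _.
by rewrite -[X in measurable X]setTI; exact: measurable_funPT.
Qed.

(* Also valid for [k >= n], where both sides vanish. *)
Lemma probability_stopping_timeS k :
  P [set w | stopping_time n X w = k.+1] =
  (survival R n k * (k.+1%:R / n%:R))%:E.
Proof.
have [nk|kn] := leqP n k.
  rewrite survival_eq0// mul0r [X in P X](_ : _ = set0) ?measure0//.
  by apply/seteqP; split => w //= h; have := stopping_time_le w; rewrite h; lia.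
rewrite stopping_time_eqS// (X_indep (B := fun j => if (j <= k)%N
  then [set m | (j < m)%N] else [set m | (m <= j)%N])) ?iota_uniq//.
(* Splitting off the stopping round, of probability (k+1)/n, leaves the k failing rounds, whose
   product is S_k. *)
have -> : iota 1 k.+1 = iota 1 k ++ [:: k.+1].
  by rewrite -{1}(addn1 k) iotaD add1n.
rewrite big_cat/= big_seq1 ltnn (uniform_le n_gt0 (X_unif _))//.
rewrite [RHS]EFinM -prod_uniform_gt ?(ltnW kn)//; congr (_ * _)%E.
by apply: eq_big_seq => j; rewrite mem_iota add1n ltnS => /andP[_ ->].
Qed.

Lemma pmf_gain k : (0 < k)%N ->
  pmf (gain_rv n X) k%:R = survival R n k.-1 * (k%:R / n%:R).
Proof.
case: k => // k _; rewrite /pmf -[RHS]/(fine (_)%:E).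
rewrite -probability_stopping_timeS; congr (fine (P _)).
apply/seteqP; split => w /=; rewrite /gain_rv /gain; last by move->.
by move/eqP; rewrite eqr_nat => /eqP.
Qed.

Lemma cdf_gain_lt0 x : x < 0 -> cdf (gain_rv n X) x = 0%E.
Proof.
move=> x0; rewrite /cdf /distribution /pushforward.
rewrite [X in P X](_ : _ = set0) ?measure0//.
apply/seteqP; split => w //=; rewrite in_itv/= /gain_rv /gain.
by apply/negP; rewrite -ltNge (lt_le_trans x0).
Qed.

(** The gain is integer-valued, so the event is the disjoint union of the level sets 0, ..., [chi],
    whose probabilities telescope. *)
Lemma cdf_gain x chi : Num.floor x = chi%:Z ->
  cdf (gain_rv n X) x = (1 - survival R n chi)%:E.
Proof.
move=> fx; rewrite /cdf /distribution /pushforward.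
have -> : gain_rv n X @^-1` `]-oo, x] =
    \big[setU/set0]_(i < chi.+1) [set w | stopping_time n X w = i].
  rewrite -(bigcup_mkord _ (fun i => [set w | stopping_time n X w = i])).
  apply/seteqP; split => w /=.
    rewrite in_itv/= /gain_rv /gain => h.
    exists (stopping_time n X w) => //=; rewrite ltnS -lez_nat -fx.
    by rewrite floor_ge_int.
  move=> [i /= ilt si]; rewrite in_itv/= /gain_rv /gain si.
  by rewrite -[i%:R]/(i%:Z%:~R) -floor_ge_int fx lez_nat -ltnS.
have tr : trivIset setT (fun i => [set w | stopping_time n X w = i]).
  by move=> i j _ _ [w [/= <- <-]].
rewrite (measure_bigsetU P measurable_stopping_time tr).
rewrite -(big_mkord xpredT (fun i => P [set w | stopping_time n X w = i])).
(* The level 0 is the default value, a null event. *)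
rewrite big_nat_recl// probability_stopping_time0 add0e.
rewrite -sum_survival [in RHS]big_add1/= -sumEFin.
by apply: eq_bigr => i _; rewrite probability_stopping_timeS.
Qed.

End stopping_time.

(** * The three claims, by algebra on S_k *)

Theorem mainTheorem1 (d : measure_display) (T : measurableType d)
  (R : realType) (P : probability T R) (X : nat -> {RV P >-> nat})
  (n : nat) (n_gt0 : (0 < n)%N)
  (X_indep : mutually_independent [set k : nat | (1 <= k)%N] X)
  (X_unif : forall k : nat, (1 <= k)%N -> uniform_on_1n n (X k)) :
  let G : {RV P >-> R} := gain_rv n X in
  let p (k : nat) : R := pmf G k%:R in
  (* (1) *)
  [/\ p 1%N = 1 / n%:R,
      forall k : nat, (2 <= k <= n)%N ->
        p k = (1 - \sum_(1 <= i < k) p i) * (k%:R / n%:R) /\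
        p k = p k.-1 * k%:R * (1 / k.-1%:R - 1 / n%:R),
      p n = 1 - \sum_(1 <= i < n) p i &
      \sum_(1 <= k < n.+1) p k = 1] /\
  (* (2) *)
  ((forall k : nat, (2 <= k <= n)%N ->
      p k = 1 / n%:R *
        \prod_(2 <= i < k.+1) (i%:R * (1 / i.-1%:R - 1 / n%:R))) /\
   (forall k : nat, (1 <= k <= n)%N ->
      p k = k%:R / n%:R ^+ k * ((n.-1)`!%:R / (n - k)`!%:R))) /\
  (* (3) *)
  (forall x : R,
    (x < 0 -> cdf G x = 0%E) /\
    (forall chi : nat, Num.floor x = chi%:Z ->
      [/\ cdf G x = (\sum_(1 <= i < chi.+1) p i)%:E,
          (chi < n)%N ->
            cdf G x =
              (1 - (n.-1)`!%:R / (n%:R ^+ chi * (n.-1 - chi)`!%:R))%:E &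
          (n <= chi)%N -> cdf G x = 1%E])).
Proof.
move=> G p.
have n0 : n%:R != 0 :> R by rewrite pnatr_eq0 -lt0n.
have pE k : (0 < k)%N -> p k = survival R n k.-1 * (k%:R / n%:R).
  exact: pmf_gain.
have sumE k : \sum_(1 <= i < k.+1) p i = 1 - survival R n k.
  by rewrite -sum_survival; apply: eq_big_nat => i /andP[i1 _]; exact: pE.
have p1 : p 1%N = 1 / n%:R by rewrite pE// survival0 mul1r.
(* By S_(k-1) = S_(k-2) (1 - (k-1)/n), the ratio of consecutive masses is k/(k-1) times 1 -
   (k-1)/n. *)
have pred k : (2 <= k)%N ->
    p k = p k.-1 * (k%:R * (1 / k.-1%:R - 1 / n%:R)).
  case: k => [|[|k]]// _; rewrite !pE//= survivalS.
  have k0 : k.+1%:R != 0 :> R by rewrite pnatr_eq0.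
  move: k0 n0; move: (k.+1%:R : R) (k.+2%:R : R) (n%:R : R) => a b c a0 c0.
  by field; rewrite a0 c0.
split; [split => //|split; [split|]].
- move=> k /andP[k2 _]; split; last by rewrite pred// mulrA.
  by case: k k2 => // k _; rewrite sumE opprB addrCA subrr addr0 pE.
(* At k = n the factor k/n is 1, so the last mass is S_(n-1). *)
- case: (n) (n_gt0) sumE pE n0 => // m _ sumE pE n0.
  by rewrite sumE opprB addrCA subrr addr0 pE// divff// mulr1.
- by rewrite sumE survival_eq0// subr0.
- move=> k /andP[+ _]; elim: k => // -[|[|k]] IH // _.
    by rewrite pred// p1 big_nat1.
  by rewrite pred// IH// -[LHS]mulrA; congr (_ * _); rewrite [RHS]big_nat_recr.
(* The closed form is used at k - 1 < n, where (n-1) - (k-1) = n - k. *)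
- move=> k /andP[k1 kn]; rewrite pE// survival_fact//; last by lia.
  case: k k1 kn => // k _ kn /=; have -> : (n.-1 - k = n - k.+1)%N by lia.
  have f0 : (n - k.+1)`!%:R != 0 :> R by rewrite pnatr_eq0 -lt0n fact_gt0.
  by rewrite exprS; field; apply/and3P; split => //; exact: expf_neq0.
- move=> x; split; first exact: cdf_gain_lt0.
  move=> chi fx; have cdfE : cdf G x = (1 - survival R n chi)%:E.
    exact: cdf_gain.
  split; first by rewrite cdfE sumE.
    by move=> chin; rewrite cdfE survival_fact.
  by move=> nchi; rewrite cdfE survival_eq0// subr0.
Qed.
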